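(* Let $v\ge 4$ be a multiple of $3$. The hypergraph $K_v^{(3)}-I$ admits a decomposition into tight $6$-cycles if and only if $v\equiv 0,3,6 \pmod{12}$.
   Context: $K_v^{(3)}$ denotes the complete $3$-uniform hypergraph on $v$ vertices (all $3$-element subsets of the vertex set are edges). For $3\mid v$, $K_v^{(3)}-I$ denotes the hypergraph obtained from $K_v^{(3)}$ by deleting the edges of a $1$-factor $I$, i.e. a set of $v/3$ pairwise disjoint triples covering all vertices (the choice of $I$ is irrelevant up to isomorphism). A (3-uniform tight) $k$-cycle is given by a cyclic sequence $v_1,v_2,\dots,v_k$ of $k$ distinct vertices, its edges being the $k$ triples $\{v_i,v_{i+1},v_{i+2}\}$, $i=1,\dots,k$, with indices taken modulo $k$. A decomposition of a hypergraph $\mathcal H$ into $k$-cycles is a collection of $k$-cycles (sub-hypergraphs of $\mathcal H$) whose edge sets partition the edge set of $\mathcal H$. *)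

(* Defs.v *)
From mathcomp Require Import all_boot.
Set Implicit Arguments. Unset Strict Implicit. Unset Printing Implicit Defensive.

(* Vertex set {0,...,v-1} = 'I_v; a 3-uniform hypergraph is a set of 3-subsets. *)

Definition complete3 (v : nat) : {set {set 'I_v}} :=
  [set e : {set 'I_v} | #|e| == 3].

Definition one_factor (v : nat) (I : {set {set 'I_v}}) : bool :=
  [&& I \subset complete3 v, trivIset I & cover I == [set: 'I_v]].

Definition complete3_minus (v : nat) (I : {set {set 'I_v}}) : {set {set 'I_v}} :=
  complete3 v :\: I.

(* A tight k-cycle given by a cyclic sequence c_0,...,c_{k-1} of distinct
   vertices; its edges are {c_i, c_{i+1}, c_{i+2}}, indices mod k. *)
Definition tight_cycle (k v : nat) (c : {ffun 'I_k -> 'I_v}) : bool :=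
  injectiveb c.

Definition cycle_edges (k v : nat) (c : {ffun 'I_k -> 'I_v}) : {set {set 'I_v}} :=
  [set [set c i; c (ordS i); c (ordS (ordS i))] | i : 'I_k].

Definition k_cycle_decomposition (k v : nat) (H : {set {set 'I_v}})
    (cs : seq {ffun 'I_k -> 'I_v}) : Prop :=
  (forall c, c \in cs -> tight_cycle c /\ cycle_edges c \subset H) /\
  (forall e, e \in H -> count (fun c => e \in cycle_edges c) cs = 1).

Definition has_k_cycle_decomposition (k v : nat) (H : {set {set 'I_v}}) : Prop :=
  exists cs : seq {ffun 'I_k -> 'I_v}, k_cycle_decomposition H cs.

(* Main.v *)
(** Call the triples of [I] blocks, let [u] be their number, and write [K] for
    [complete3_minus I]. The 18 edges of [K] meeting exactly two given blocks form a
    [K_6] minus two disjoint edges, which splits into three 6-cycles. The 27 edges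
    meeting three given blocks form a complete tripartite hypergraph. Hence [K] has
    [18 C(u, 2) + 27 C(u, 3)] edges, and a decomposition forces [C(u, 3)] to be even,
    that is, [u mod 4 <> 3]. Conversely, the edges meeting all of [A], [B], [C] and
    those meeting all of [A], [B], [D] together form a complete tripartite hypergraph
    with parts of sizes 3, 3, 6, which splits into nine 6-cycles. It remains to pair
    up the 3-sets of blocks so that partners share two blocks: list them in
    revolving-door order, a Gray code in which consecutive sets differ by the exchange
    of one element, and pair the first with the second, the third with the fourth,
    and so on. *)
Require Import Defs.
From mathcomp Require Import all_boot zify.
Set Implicit Arguments. Unset Strict Implicit. Unset Printing Implicit Defensive.

Lemma odd_bin2 n : odd 'C(n, 2) = (1 < n %% 4).
Proof. by elim: n => // n IH; rewrite binS bin1 oddD IH; lia. Qed.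

Lemma odd_bin3 n : odd 'C(n, 3) = (n %% 4 == 3).
Proof. by elim: n => // n IH; rewrite binS oddD IH odd_bin2; lia. Qed.

Lemma card_enumeration (T : finType) (A : {set T}) n : #|A| = n ->
  exists f : 'I_n -> T,
    [/\ injective f, forall i, f i \in A & A = [set f i | i : 'I_n]].
Proof.
move=> <-; exists enum_val; split; [exact: enum_val_inj | exact: enum_valP |].
apply/setP=> x; apply/idP/imsetP => [xA|[i _ ->]]; last exact: enum_valP.
by exists (enum_rank_in xA x) => //; rewrite enum_rankK_in.
Qed.

Lemma card_set3 (T : finType) (x y z : T) :
  (#|[set x; y; z]| == 3) = uniq [:: x; y; z].
Proof.
rewrite /= !inE setUC cardsU1 cards2 !inE negb_or (eq_sym z x) (eq_sym z y).
by case: (x == y) (x == z) (y == z) => [] [] [].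
Qed.

Lemma disjointsUl (T : finType) (A B C : {set T}) :
  [disjoint A :|: B & C] = [disjoint A & C] && [disjoint B & C].
Proof. by rewrite disjoints_subset subUset -!disjoints_subset. Qed.

Lemma disjoint_neq (T : finType) (A B : {set T}) x y :
  [disjoint A & B] -> x \in A -> y \in B -> (x == y = false) * (y == x = false).
Proof.
move=> AB xA yB; rewrite (eq_sym y); have -> // : x == y = false.
by apply: contraTF yB => /eqP<-; rewrite (disjointFr AB xA).
Qed.

Lemma subset_cards2 (T : finType) (S I : {set T}) : S \subset I -> #|S| = 2 ->
  exists A B, [/\ A \in I, B \in I, A != B & S = [set A; B]].
Proof.
move=> SI /eqP/cards2P[A [B [AB SAB]]]; exists A, B; move: SI.
by rewrite SAB subUset !sub1set => /andP[].
Qed.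

Lemma subset_cards3 (T : finType) (S I : {set T}) : S \subset I -> #|S| = 3 ->
  exists A B C, [/\ A \in I, B \in I, C \in I, uniq [:: A; B; C] & S = [set A; B; C]].
Proof.
move=> SI S3; have /card_gt0P[C CS] : 0 < #|S| by rewrite S3.
have [|A [B [AI BI AB SAB]]] := subset_cards2 (subset_trans (subD1set S C) SI).
  by move: S3; rewrite (cardsD1 C) CS => -[].
have SE : S = [set A; B; C] by rewrite -SAB setUC setD1K.
exists A, B, C; split=> //; first exact: (subsetP SI).
by rewrite -card_set3 -SE S3.
Qed.

Lemma imset_meet (aT rT : finType) (f : aT -> rT) (E : {set rT}) :
  0 < #|E :&: [set f p | p : aT]| -> exists p, f p \in E.
Proof.
move=> /card_gt0P[x /setIP[xE /imsetP[p _ xp]]].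
by exists p; rewrite -xp.
Qed.

Lemma imset_meet_but_one (aT rT : finType) (f : aT -> rT) (E : {set rT}) :
  injective f -> #|E :&: [set f p | p : aT]|.+1 = #|aT| ->
  exists p, forall q, q != p -> f q \in E.
Proof.
move=> fI E_card; have /cards1P[x /setP fE] : #|[set f p | p : aT] :\: E| == 1.
  rewrite -(eqn_add2l #|E :&: [set f p | p : aT]|) addn1 E_card.
  by rewrite setIC cardsID card_imset.
have /setDP[/imsetP[p _ xp] _] : x \in [set f p | p : aT] :\: E by rewrite fE set11.
exists p => q; apply: contraR => qE.
by rewrite -(inj_eq fI) -xp -in_set1 -fE !inE qE imset_f.
Qed.

Section RevolvingDoor.

Variable T : finType.
Implicit Types (A B : {set T}) (s : seq T).

Definition exchange A B := (#|A :\: B| == 1) && (#|B :\: A| == 1).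

Lemma exchange_sym : symmetric exchange.
Proof. by move=> A B; rewrite /exchange andbC. Qed.

Lemma setU1D x A B : x \notin A -> (x |: A) :\: (x |: B) = A :\: B.
Proof.
move=> xA; apply/setP=> y; rewrite !inE.
by case: eqP => // ->; rewrite (negPf xA) andbF.
Qed.

Lemma exchange_setU1l x A B :
  x \notin A -> x \notin B -> exchange (x |: A) (x |: B) = exchange A B.
Proof. by move=> xA xB; rewrite /exchange !setU1D. Qed.

Lemma exchange_setU1r x y A :
  x != y -> x \notin A -> y \notin A -> exchange (x |: A) (y |: A).
Proof.
have setU1_neqD z t : z != t -> z \notin A -> (z |: A) :\: (t |: A) = [set z].
  move=> zt zA; apply/setP=> w; rewrite !inE.
  case: (eqVneq w z) => [->|_] /=; first by rewrite (negPf zt) (negPf zA).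
  by case: (w \in A); rewrite ?orbT ?andbF.
by move=> xy xA yA; rewrite /exchange !setU1_neqD ?cards1 // eq_sym.
Qed.

Fixpoint revolving_door s k : seq {set T} :=
  match s, k with
  | _, 0 => [:: set0]
  | [::], _.+1 => [::]
  | x :: s', k'.+1 => revolving_door s' k ++
      [seq x |: A | A <- rev (revolving_door s' k')]
  end.

Lemma revolving_door0 s : revolving_door s 0 = [:: set0].
Proof. by case: s. Qed.

Lemma size_revolving_door s k : size (revolving_door s k) = 'C(size s, k).
Proof.
elim: s k => [|x s IH] [|k] //.
by rewrite size_cat size_map size_rev !IH binS.
Qed.

Lemma mem_revolving_door s k A :
  uniq s -> (A \in revolving_door s k) = (A \subset s) && (#|A| == k).
Proof.
have card0_sub (s' : seq T) B : (B \in [:: set0]) = (B \subset s') && (#|B| == 0).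
  rewrite inE cards_eq0; apply/esym/andb_idl => /eqP->.
  by apply/subsetP=> y; rewrite inE.
elim: s k A => [|x s IH] [|k] A.
- by move=> _; apply: card0_sub.
- move=> _ /=; apply/esym/negP => /andP[/subsetP sA /eqP cA].
  by have /set0Pn[x /sA] : A != set0 by rewrite -cards_eq0 cA.
- by move=> _; apply: card0_sub.
case/andP=> xs us; rewrite /= mem_cat IH //.
have notin_sub B : B \subset s -> x \notin B.
  by move=> /subsetP sB; apply: contra xs => /sB.
have -> : (A \subset x :: s) = (A :\ x \subset s).
  apply/subsetP/subsetP => sA y.
    by rewrite !inE => /andP[/negPf yx /sA]; rewrite inE yx.
  by move=> yA; rewrite inE; case: eqVneq => //= yx; apply: sA; rewrite !inE yx.
have [xA|xA] := boolP (x \in A); last first.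
  have -> : A :\ x = A by apply/setDidPl; rewrite disjoint_sym disjoints1.
  by apply/orb_idr => /mapP[B _ AB]; rewrite AB setU11 in xA.
have -> /= : (A \subset s) = false by apply: contraTF xA => /notin_sub.
transitivity (A :\ x \in revolving_door s k).
  apply/mapP/idP => [[B + ->]|Ax]; last by exists (A :\ x); rewrite ?mem_rev ?setD1K.
  rewrite mem_rev => Bs; rewrite setU1K // notin_sub //.
  by move: Bs; rewrite IH // => /andP[].
by rewrite IH // (cardsD1 x A) xA eqSS.
Qed.

Lemma notin_revolving_door x s k A :
  uniq (x :: s) -> A \in revolving_door s k -> x \notin A.
Proof.
move=> /andP[xs us]; rewrite mem_revolving_door // => /andP[/subsetP As _].
by apply: contra xs => /As.
Qed.

Lemma revolving_door_uniq s k : uniq s -> uniq (revolving_door s k).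
Proof.
elim: s k => [|x s IH] [|k] // uxs; have /andP[_ us] := uxs.
rewrite /= cat_uniq !IH //= map_inj_in_uniq ?rev_uniq ?IH ?andbT //.
  apply/hasPn => _ /mapP[A _ ->]; apply/negP => /(notin_revolving_door uxs).
  by rewrite setU11.
move=> A B; rewrite !mem_rev => /(notin_revolving_door uxs) xA.
by move=> /(notin_revolving_door uxs) xB AB; rewrite -(setU1K xA) AB setU1K.
Qed.

Lemma revolving_door_cat_uniq s j k :
  uniq s -> j != k -> uniq (revolving_door s j ++ revolving_door s k).
Proof.
move=> us jk; rewrite cat_uniq !revolving_door_uniq // andbT.
apply/hasPn => A; rewrite !mem_revolving_door // => /andP[_ /eqP->].
by rewrite [k == j]eq_sym (negPf jk) andbF.
Qed.

Lemma head_revolving_door s k : k <= size s ->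
  head set0 (revolving_door s k) = [set:: drop (size s - k) s].
Proof.
elim: s k => [|x s IH] [|k] //; first by rewrite subn0 drop_size set_nil.
rewrite /= ltnS leq_eqVlt => /predU1P[->|ks].
  have := size_revolving_door s (size s); rewrite binn.
  have := size_revolving_door s (size s).+1; rewrite bin_small // => /size0nil->.
  have := IH (size s) (leqnn _); rewrite !subnn !drop0.
  by case: (revolving_door s _) => [|A []] //= ->; rewrite set_cons.
have := size_revolving_door s k.+1; have := IH _ ks.
case: (revolving_door s _) => [_ /esym/eqP|A l /= -> _].
  by rewrite eqn0Ngt bin_gt0 ks.
by rewrite subSS -(subnSK ks).
Qed.

Lemma last_revolving_door x s k : k <= size s ->
  last set0 (revolving_door (x :: s) k.+1) = x |: head set0 (revolving_door s k).
Proof.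
move=> ks; have := size_revolving_door s k; rewrite /= last_cat.
case: (revolving_door s k) => [/esym/eqP|A l _].
  by rewrite eqn0Ngt bin_gt0 ks.
by rewrite rev_cons map_rcons last_rcons.
Qed.

Lemma exchange_last_revolving_door x s k : uniq (x :: s) -> k < size s ->
  exchange (last set0 (revolving_door s k.+1))
           (x |: last set0 (revolving_door s k)).
Proof.
case: s => // y s /and3P[]; rewrite inE negb_or => /andP[xy xs] ys us.
have notin_drop z n : z \notin s -> z \notin [set:: drop n s].
  by move=> zs; rewrite inE; apply: contra zs; apply: mem_drop.
rewrite ltnS => ks; rewrite last_revolving_door //.
case: k => [|k] in ks *.
  by rewrite !revolving_door0 exchange_sym exchange_setU1r ?inE.
rewrite last_revolving_door ?(ltnW ks) // !head_revolving_door ?(ltnW ks) //.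
rewrite setUCA exchange_setU1l ?notin_drop //; last first.
  by rewrite in_setU1 negb_or eq_sym xy notin_drop.
have dk : size s - k = (size s - k.+1).+1 by rewrite subnSK.
have ds : size s - k.+1 < size s by rewrite -dk leq_subr.
rewrite dk (drop_nth x ds) set_cons; apply: exchange_setU1r.
- by apply: contraNneq xs => <-; rewrite mem_nth.
- have := drop_uniq (size s - k.+1) us.
  by rewrite (drop_nth x ds) inE => /andP[].
- exact: notin_drop.
Qed.

Lemma revolving_door_sorted s k : uniq s -> sorted exchange (revolving_door s k).
Proof.
elim: s k => [|x s IH] [|k] // uxs; have /andP[_ us] := uxs.
have sorted_tail : sorted exchange [seq x |: A | A <- rev (revolving_door s k)].
  rewrite sorted_map rev_sorted.
  apply: (sub_in_sorted _ (allss _) (IH k us)) => A B.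
  move=> /(notin_revolving_door uxs) xA /(notin_revolving_door uxs) xB.
  by rewrite /= exchange_sym exchange_setU1l.
rewrite /=; have := IH k.+1 us; have := exchange_last_revolving_door (k := k) uxs.
have := size_revolving_door s k.+1.
case: (revolving_door s k.+1) => [|A l] //= size_l.
rewrite -bin_gt0 -size_l cat_path => /(_ isT) + ->; move: sorted_tail.
case/lastP: (revolving_door s k) => [|m B] //=.
by rewrite rev_rcons last_rcons /= => -> ->.
Qed.

End RevolvingDoor.

Arguments exchange {T}.

Section TightCycles.

Variables k v : nat.
Implicit Types (c : {ffun 'I_k -> 'I_v}) (e : {set 'I_v}) (i j : 'I_k).

Definition cycle_edge c i : {set 'I_v} := [set c i; c (ordS i); c (ordS (ordS i))].

Definition tuple_cycle (t : k.-tuple 'I_v) : {ffun 'I_k -> 'I_v} :=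
  [ffun i => tnth t i].

Lemma tight_tuple_cycle t : tight_cycle (tuple_cycle t) = uniq t.
Proof.
apply/injectiveP/tuple_uniqP => tI i j; last by rewrite !ffunE; apply: tI.
by move=> ij; apply: tI; rewrite !ffunE.
Qed.

Lemma val_ordS i : val (ordS i) = if i.+1 == k then 0 else i.+1.
Proof.
rewrite /=; case: eqP => [->|ik]; first by rewrite modnn.
by rewrite modn_small // ltn_neqAle ltn_ord andbT; apply/eqP.
Qed.

Lemma card_cycle_edge c i : 2 < k -> tight_cycle c -> #|cycle_edge c i| = 3.
Proof.
move=> k3 /injectiveP cI; rewrite /cycle_edge setUC cardsU1 cards2 !inE.
rewrite !(inj_eq cI) -!val_eqE !val_ordS /=.
by have := ltn_ord i; do !case: ifP; lia.
Qed.

Lemma cycle_edge_inj c : 3 < k -> tight_cycle c -> injective (cycle_edge c).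
Proof.
move=> k4 /injectiveP cI i j ij; apply: val_inj => /=.
have: c i \in cycle_edge c j by rewrite -ij !inE eqxx.
have: c (ordS i) \in cycle_edge c j by rewrite -ij !inE eqxx orbT.
have: c (ordS (ordS i)) \in cycle_edge c j by rewrite -ij !inE eqxx !orbT.
rewrite !inE !(inj_eq cI) !(inj_eq (@ordS_inj k)) -!val_eqE !val_ordS /=.
by have := ltn_ord i; have := ltn_ord j; do !case: ifP; lia.
Qed.

Lemma card_cycle_edges c : 3 < k -> tight_cycle c -> #|cycle_edges c| = k.
Proof.
by move=> k4 /(cycle_edge_inj k4) cI; rewrite [LHS](card_imset _ cI) card_ord.
Qed.

Lemma mem_cycle_edges c e i : 2 < k -> tight_cycle c -> #|e| = 3 ->
  c i \in e -> c (ordS i) \in e -> c (ordS (ordS i)) \in e -> e \in cycle_edges c.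
Proof.
move=> k3 tc e3 e0 e1 e2; apply/imsetP; exists i => //; apply/eqP.
rewrite eq_sym eqEcard -/(cycle_edge c i) card_cycle_edge // e3 leqnn andbT.
by rewrite !subUset !sub1set e0 e1.
Qed.

End TightCycles.

Section Decompositions.

Variables k v : nat.
Implicit Types (c : {ffun 'I_k -> 'I_v}) (H : {set {set 'I_v}}).
Implicit Types cs : seq {ffun 'I_k -> 'I_v}.

Definition multiplicity cs (e : {set 'I_v}) : nat :=
  count (fun c => e \in cycle_edges c) cs.

Lemma k_cycle_decompositionP H cs :
  k_cycle_decomposition H cs <->
  {in cs, forall c, tight_cycle c} /\
  forall e, multiplicity cs e = (e \in H).
Proof.
split=> [[csH countH]|[tcs countE]].
  split=> [c /csH[]//|e]; rewrite /multiplicity.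
  have [/countH->//|eH] := boolP (e \in H).
  apply/eqP; rewrite -leqn0 leqNgt -has_count; apply/hasPn => c /csH[_ /subsetP cH].
  by apply: contra eH => /cH.
split=> [c ccs|e eH]; last by rewrite -/(multiplicity cs e) countE eH.
split; first exact: tcs.
apply/subsetP => e ec; rewrite -[_ \in _]lt0b -countE -[0 < _]has_count.
by apply/hasP; exists c.
Qed.

Lemma has_k_cycle_decomposition0 :
  has_k_cycle_decomposition k (set0 : {set {set 'I_v}}).
Proof. by exists [::]; split=> // e; rewrite inE. Qed.

Lemma has_k_cycle_decompositionU H1 H2 : [disjoint H1 & H2] ->
  has_k_cycle_decomposition k H1 -> has_k_cycle_decomposition k H2 ->
  has_k_cycle_decomposition k (H1 :|: H2).
Proof.
move=> dH [cs1 /k_cycle_decompositionP[tc1 count1]].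
move=> [cs2 /k_cycle_decompositionP[tc2 count2]].
exists (cs1 ++ cs2); apply/k_cycle_decompositionP; split=> [c|e].
  by rewrite mem_cat => /orP[/tc1|/tc2].
rewrite [LHS]count_cat [X in X + _]count1 [X in _ + X]count2 inE.
by have [/(disjointFr dH)->|] := boolP (e \in H1).
Qed.

Lemma sum_multiplicity cs : 3 < k -> {in cs, forall c, tight_cycle c} ->
  \sum_e multiplicity cs e = size cs * k.
Proof.
move=> k4 tcs; under eq_bigr => e _ do rewrite /multiplicity -sum1_count big_mkcond.
rewrite exchange_big /= (eq_big_seq (fun=> k)) => [|c ccs].
  by rewrite big_const_seq count_predT iter_addn_0 mulnC.
by rewrite -big_mkcond sum1_card card_cycle_edges // tcs.
Qed.

Lemma card_k_cycle_decomposition H cs : 3 < k ->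
  k_cycle_decomposition H cs -> #|H| = size cs * k.
Proof.
move=> k4 /k_cycle_decompositionP[tcs countE].
rewrite -sum_multiplicity // -sum1_card big_mkcond.
by apply: eq_bigr => e _; rewrite countE; case: ifP.
Qed.

(* There is only room for covering each edge of [H] once, and no other edge. *)
Lemma has_k_cycle_decomposition_cover (J : finType) (c : J -> {ffun 'I_k -> 'I_v}) H :
  3 < k -> (forall j, tight_cycle (c j)) ->
  {in H, forall e, exists j, e \in cycle_edges (c j)} ->
  #|J| * k <= #|H| -> has_k_cycle_decomposition k H.
Proof.
move=> k4 tc covH sizeH; exists (codom c); apply/k_cycle_decompositionP.
have tcs : {in codom c, forall d, tight_cycle d} by move=> _ /codomP[j ->].
split=> // e.
have mem_le e' : true -> (e' \in H) <= multiplicity (codom c) e'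
    ?= iff ((e' \in H : nat) == multiplicity (codom c) e').
  move=> _; apply: leqif_eq; case: (boolP (e' \in H)) => // /covH[j ej].
  by rewrite -has_count; apply/hasP; exists (c j); rewrite ?codom_f.
have := geq_leqif (leqif_sum mem_le); rewrite sum_multiplicity // size_codom.
have -> : \sum_e' (e' \in H) = #|H|.
  by rewrite -sum1_card [RHS]big_mkcond; apply: eq_bigr => e' _; case: ifP.
by rewrite sizeH => /esym/forall_inP/(_ e isT)/eqP.
Qed.

End Decompositions.

Section TripleSystems.

Variable T : finType.
Implicit Types A B C D e : {set T}.

Definition tripartite A B C : {set {set T}} :=
  [set [set t.1.1; t.1.2; t.2] | t in setX (setX A B) C].

Lemma tripartiteP A B C e :
  reflect (exists x y z, [/\ x \in A, y \in B, z \in C & e = [set x; y; z]])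
          (e \in tripartite A B C).
Proof.
apply: (iffP imsetP) => [[[[x y] z]]|[x [y [z [xA yB zC ->]]]]].
  by rewrite !in_setX /= => /andP[/andP[xA yB] zC] ->; exists x, y, z.
by exists (x, y, z); rewrite // !in_setX xA yB.
Qed.

Lemma tripartiteUr A B C D :
  tripartite A B (C :|: D) = tripartite A B C :|: tripartite A B D.
Proof.
rewrite /tripartite.
have -> : setX (setX A B) (C :|: D) = setX (setX A B) C :|: setX (setX A B) D.
  by apply/setP=> t; rewrite !inE -andb_orr.
exact: imsetU.
Qed.

Lemma card_tripartite A B C : [disjoint A & B] -> [disjoint A :|: B & C] ->
  #|tripartite A B C| = #|A| * #|B| * #|C|.
Proof.
move=> AB; rewrite disjointsUl => /andP[AC BC].
rewrite card_in_imset ?cardsX // => -[[x y] z] [[x' y'] z'].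
rewrite !in_setX /= => /andP[/andP[xA yB] zC] /andP[/andP[xA' yB'] zC'] /setP E.
have := E x; have := E y; have := E z; rewrite !inE !eqxx ?orbT.
rewrite !(disjoint_neq AB xA yB') !(disjoint_neq AC xA zC') !(disjoint_neq AB xA' yB).
rewrite !(disjoint_neq BC yB zC') !(disjoint_neq AC xA' zC) !(disjoint_neq BC yB' zC).
by rewrite !orbF => /esym/eqP-> /esym/eqP-> /esym/eqP->.
Qed.

Lemma card_mem_tripartite A B C e : [disjoint A & B] -> [disjoint A :|: B & C] ->
  e \in tripartite A B C -> #|e| = 3.
Proof.
move=> AB; rewrite disjointsUl => /andP[AC BC].
case/tripartiteP=> x [y [z [xA yB zC ->]]]; apply/eqP; rewrite card_set3 /= !inE.
by rewrite (disjoint_neq AB xA yB) (disjoint_neq AC xA zC) (disjoint_neq BC yB zC).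
Qed.

Definition crossing_triples A B : {set {set T}} :=
  [set e : {set T} | e \subset A :|: B & #|e| == 3] :\: [set A; B].

Lemma card_crossing_triples A B :
  #|A| = 3 -> #|B| = 3 -> [disjoint A & B] -> #|crossing_triples A B| = 18.
Proof.
move=> A3 B3 dAB; have AB : A != B.
  apply: contraTneq dAB => ->; rewrite -setI_eq0 setIid.
  by rewrite -cards_eq0 B3.
rewrite cardsD cards_draws cardsU disjoint_setI0 // cards0 A3 B3 /=.
rewrite (setIidPr _) ?cards2 ?AB //; apply/subsetP => e.
by rewrite !inE => /orP[] /eqP->; rewrite ?A3 ?B3 ?subsetUl ?subsetUr.
Qed.

Lemma card_setI_crossing_triples A B e :
  #|A| = 3 -> #|B| = 3 -> [disjoint A & B] -> e \in crossing_triples A B ->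
  (#|e :&: A| = 2 /\ #|e :&: B| = 1) \/ (#|e :&: A| = 1 /\ #|e :&: B| = 2).
Proof.
move=> A3 B3 dAB; rewrite !inE negb_or => /andP[/andP[eA eB] /andP[eAB /eqP e3]].
have eAB3 : #|e :&: A| + #|e :&: B| = 3.
  rewrite -cardsUI -setIUr (setIidPl eAB) setIACA setIid (disjoint_setI0 dAB).
  by rewrite setI0 cards0 addn0.
have not3 (X : {set T}) : #|X| = 3 -> e != X -> #|e :&: X| != 3.
  move=> X3; apply: contraNneq => eX3; rewrite eqEcard X3 e3 leqnn andbT.
  by apply/setIidPl/eqP; rewrite eqEcard subsetIl e3 eX3.
by have := not3 _ A3 eA; have := not3 _ B3 eB; lia.
Qed.

End TripleSystems.

Lemma ord3_neqS (p : 'I_3) : (p == ordS p) = false.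
Proof. by case: p => [[|[|[]]]]. Qed.

Lemma ord3_neqSS (p : 'I_3) : (p == ordS (ordS p)) = false.
Proof. by case: p => [[|[|[]]]]. Qed.

Lemma ord3_SSS (p : 'I_3) : ordS (ordS (ordS p)) = p.
Proof. by apply: val_inj; case: p => [[|[|[]]]]. Qed.

Lemma ord3_orbit (p q : 'I_3) : [|| q == p, q == ordS p | q == ordS (ordS p)].
Proof. by case: p q => [[|[|[]]]] // ? [[|[|[]]]]. Qed.

Lemma ord3_imset_meet2 (rT : finType) (f : 'I_3 -> rT) (E : {set rT}) :
  injective f -> #|E :&: [set f p | p : 'I_3]| = 2 ->
  exists p, f (ordS p) \in E /\ f (ordS (ordS p)) \in E.
Proof.
move=> fI E2; have [|p fp] := imset_meet_but_one (E := E) fI.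
  by rewrite E2 card_ord.
by exists p; split; apply: fp; rewrite eq_sym ?ord3_neqS ?ord3_neqSS.
Qed.

Section SixCycles.

Variable v : nat.
Implicit Types A B C D e : {set 'I_v}.

Lemma mem_tuple6_cycle_edges (x0 x1 x2 x3 x4 x5 : 'I_v) e :
  uniq [:: x0; x1; x2; x3; x4; x5] -> #|e| = 3 ->
  [|| [&& x0 \in e, x1 \in e & x2 \in e], [&& x1 \in e, x2 \in e & x3 \in e],
      [&& x2 \in e, x3 \in e & x4 \in e], [&& x3 \in e, x4 \in e & x5 \in e],
      [&& x4 \in e, x5 \in e & x0 \in e] | [&& x5 \in e, x0 \in e & x1 \in e]] ->
  e \in cycle_edges (tuple_cycle [tuple x0; x1; x2; x3; x4; x5]).
Proof.
move=> ux e3 consecutive; set t := [tuple _; _; _; _; _; _].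
have tt : tight_cycle (tuple_cycle t) by rewrite tight_tuple_cycle.
have mem_at (i : nat) (i6 : i < 6) : nth x0 t i \in e ->
    nth x0 t (i.+1 %% 6) \in e -> nth x0 t ((i.+1 %% 6).+1 %% 6) \in e ->
    e \in cycle_edges (tuple_cycle t).
  move=> e0 e1 e2; apply: (mem_cycle_edges (i := Ordinal i6)) => //;
    by rewrite ffunE (tnth_nth x0).
case/or4P: consecutive => [|||/or3P[]] /and3P[*];
  by [apply: (mem_at 0) | apply: (mem_at 1) | apply: (mem_at 2)
     | apply: (mem_at 3) | apply: (mem_at 4) | apply: (mem_at 5)].
Qed.

Lemma has_k_cycle_decomposition_tripartite A B C D :
  #|A| = 3 -> #|B| = 3 -> #|C| = #|D| ->
  [disjoint A & B] -> [disjoint C & D] -> [disjoint A :|: B & C :|: D] ->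
  has_k_cycle_decomposition 6 (tripartite A B (C :|: D)).
Proof.
move=> A3 B3; move Dn: #|D| => n Cn dAB dCD dABCD.
have [a [aI aA Aa]] := card_enumeration A3.
have [b [bI bB Bb]] := card_enumeration B3.
have [c [_ cC Cc]] := card_enumeration Cn.
have [d [_ dD Dd]] := card_enumeration Dn.
(* The pairs joined to [c i] are those of indices (p, p+1), (p+1, p+1), (p+1, p)
   modulo 3, and the pairs joined to [d i] are (p+1, p), (p, p), (p, p+1). *)
pose t p i := [tuple a p; b (ordS p); c i; a (ordS p); b p; d i].
have t_uniq p i : uniq (t p i).
  have [[dAC dAD] [dBC dBD]] : ([disjoint A & C] * [disjoint A & D]) *
      ([disjoint B & C] * [disjoint B & D]).
    by do !split; apply: disjointW dABCD; rewrite ?subsetUl ?subsetUr.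
  have ab q r := disjoint_neq dAB (aA q) (bB r).
  have ac q := disjoint_neq dAC (aA q) (cC i).
  have ad q := disjoint_neq dAD (aA q) (dD i).
  have bc q := disjoint_neq dBC (bB q) (cC i).
  have bd q := disjoint_neq dBD (bB q) (dD i).
  rewrite /= !inE !(inj_eq aI) !(inj_eq bI) !ab !ac !ad !bc !bd.
  by rewrite (disjoint_neq dCD (cC i) (dD i)) (eq_sym (ordS p)) ord3_neqS.
apply: (has_k_cycle_decomposition_cover
  (c := fun pi => tuple_cycle (t pi.1 pi.2))) => //.
- by move=> pi; rewrite tight_tuple_cycle t_uniq.
- move=> e eH; have e3 := card_mem_tripartite dAB dABCD eH.
  have /tripartiteP[x [y [z []]]] := eH.
  rewrite Aa Bb Cc Dd => /imsetP[p _ ->] /imsetP[q _ ->] zCD ee.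
  have ae : a p \in e by rewrite ee !inE eqxx.
  have be : b q \in e by rewrite ee !inE eqxx orbT.
  have ze : z \in e by rewrite ee !inE eqxx orbT.
  case/setUP: zCD => /imsetP[i _ zi]; rewrite zi in ze;
    case/or3P: (ord3_orbit p q) => /eqP qp; rewrite qp in be;
    [ exists (ordS (ordS p), i) | exists (p, i) | exists (ordS (ordS p), i)
    | exists (p, i) | exists (p, i) | exists (ordS (ordS p), i) ];
    by apply: (mem_tuple6_cycle_edges (t_uniq _ _) e3); rewrite ?ord3_SSS ae be ze ?orbT.
- rewrite card_prod !card_ord card_tripartite // A3 B3 cardsU Cn Dn.
  by rewrite disjoint_setI0 // cards0; lia.
Qed.

Lemma has_k_cycle_decomposition_crossing_triples A B :
  #|A| = 3 -> #|B| = 3 -> [disjoint A & B] ->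
  has_k_cycle_decomposition 6 (crossing_triples A B).
Proof.
move=> A3 B3 dAB; have [a [aI aA Aa]] := card_enumeration A3.
have [b [bI bB Bb]] := card_enumeration B3.
(* A triple meeting [A] in all but [a p] and [B] in [b q] has type [q - p] modulo 3:
   the cycle contains one triple of each type, and likewise with [A] and [B]
   exchanged. *)
pose t r :=
  [tuple a r; a (ordS r); b r; a (ordS (ordS r)); b (ordS (ordS r)); b (ordS r)].
have t_uniq r : uniq (t r).
  have ab p q := disjoint_neq dAB (aA p) (bB q).
  rewrite /= !inE !(inj_eq aI) !(inj_eq bI) !ab (inj_eq (@ordS_inj 3)).
  by rewrite (eq_sym (ordS (ordS r))) !ord3_neqS ord3_neqSS.
apply: (has_k_cycle_decomposition_cover (c := fun r => tuple_cycle (t r))) => //.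
- by move=> r; rewrite tight_tuple_cycle t_uniq.
- move=> e eH; have e3 : #|e| = 3 by move: eH; rewrite !inE => /and3P[_ _ /eqP].
  case: (card_setI_crossing_triples A3 B3 dAB eH) => [[eA2 eB1]|[eA1 eB2]].
  + rewrite Aa in eA2; rewrite Bb in eB1.
    have [p [ap app]] := ord3_imset_meet2 aI eA2.
    have [q be] : exists q, b q \in e by apply: imset_meet; rewrite eB1.
    case/or3P: (ord3_orbit p q) => /eqP qp; rewrite qp in be;
      [exists p | exists (ordS p) | exists (ordS p)];
      by apply: (mem_tuple6_cycle_edges (t_uniq _) e3); rewrite ?ord3_SSS ap app be ?orbT.
  + rewrite Aa in eA1; rewrite Bb in eB2.
    have [p [bp bpp]] := ord3_imset_meet2 bI eB2.
    have [q ae] : exists q, a q \in e by apply: imset_meet; rewrite eA1.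
    case/or3P: (ord3_orbit p q) => /eqP qp; rewrite qp in ae;
      [exists p | exists (ordS (ordS p)) | exists p];
      by apply: (mem_tuple6_cycle_edges (t_uniq _) e3); rewrite ?ord3_SSS bp bpp ae ?orbT.
- by rewrite card_ord card_crossing_triples.
Qed.

End SixCycles.

Section OneFactor.

Variables (v : nat) (I : {set {set 'I_v}}).
Hypothesis I_one_factor : one_factor I.
Implicit Types (A B C D e : {set 'I_v}) (R S : {set {set 'I_v}}).
Implicit Type l : seq {set {set 'I_v}}.

Lemma one_factor_trivIset : trivIset I.
Proof. by case/and3P: I_one_factor. Qed.

Lemma one_factor_mem_card B : B \in I -> #|B| = 3.
Proof. by case/and3P: I_one_factor => /subsetP I3 _ _ /I3; rewrite inE => /eqP. Qed.

Lemma one_factor_cover x : x \in cover I.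
Proof. by case/and3P: I_one_factor => _ _ /eqP->. Qed.

Lemma one_factor_disjoint A B : A \in I -> B \in I -> A != B -> [disjoint A & B].
Proof. exact: (trivIsetP one_factor_trivIset). Qed.

Lemma card_one_factor : v = 3 * #|I|.
Proof.
transitivity (\sum_(B in I) #|B|).
  move/eqP: one_factor_trivIset ->; case/and3P: I_one_factor => _ _ /eqP->.
  by rewrite cardsT card_ord.
by rewrite (eq_bigr (fun=> 3)) ?sum_nat_const 1?mulnC // => B /one_factor_mem_card.
Qed.

Definition blocks e : {set {set 'I_v}} := [set pblock I x | x in e].

Lemma blocks_sub e : blocks e \subset I.
Proof. by apply/subsetP => _ /imsetP[x _ ->]; rewrite pblock_mem ?one_factor_cover. Qed.

Lemma sub_blocks e S : S \subset I -> (blocks e \subset S) = (e \subset cover S).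
Proof.
move=> /subsetP SI; apply/subsetP/subsetP => [eS x xe|eS _ /imsetP[x xe ->]].
  apply/bigcupP; exists (pblock I x); first by apply: eS; apply: imset_f.
  by rewrite mem_pblock one_factor_cover.
have /bigcupP[B BS xB] := eS x xe.
by rewrite (def_pblock one_factor_trivIset (SI _ BS) xB).
Qed.

Lemma sub_blocks1 e B : B \in I -> (blocks e \subset [set B]) = (e \subset B).
Proof. by move=> BI; rewrite sub_blocks ?sub1set // cover1. Qed.

Lemma one_factor_sub_eq e B : #|e| = 3 -> B \in I -> (e \subset B) = (e == B).
Proof. by move=> e3 BI; rewrite eqEcard e3 one_factor_mem_card // andbT. Qed.

Lemma blocks1 e B : #|e| = 3 -> B \in I -> (blocks e == [set B]) = (e == B).
Proof.
move=> e3 BI; rewrite eqEsubset sub_blocks1 // one_factor_sub_eq // sub1set.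
apply/andb_idr => /eqP->.
have /card_gt0P[x xB] : 0 < #|B| by rewrite one_factor_mem_card.
by apply/imsetP; exists x; rewrite // (def_pblock one_factor_trivIset BI xB).
Qed.

Lemma mem_one_factor e : #|e| = 3 -> (e \in I) = (#|blocks e| == 1).
Proof.
move=> e3; apply/idP/cards1P => [eI|[B eB]].
  by exists e; apply/eqP; rewrite blocks1.
have BI : B \in I by rewrite -sub1set -eB blocks_sub.
by move/eqP: eB; rewrite blocks1 // => /eqP->.
Qed.

Definition edges_over l : {set {set 'I_v}} :=
  [set e in complete3 v | blocks e \in l].

Lemma edges_over_cat l1 l2 : edges_over (l1 ++ l2) = edges_over l1 :|: edges_over l2.
Proof. by apply/setP => e; rewrite !inE mem_cat andb_orr. Qed.

Lemma edges_over_disjoint l1 l2 :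
  uniq (l1 ++ l2) -> [disjoint edges_over l1 & edges_over l2].
Proof.
rewrite cat_uniq => /and3P[_ /hasPn l12 _]; rewrite disjoints_subset.
apply/subsetP => e; rewrite !inE => /andP[-> el1] /=.
by apply: contraL el1 => /l12.
Qed.

Lemma edges_over_nil : edges_over [::] = set0.
Proof. by apply/setP => e; rewrite !inE andbF. Qed.

Lemma card_edges_over l n : uniq l ->
  {in l, forall S, #|edges_over [:: S]| = n} -> #|edges_over l| = size l * n.
Proof.
elim: l => [|S l IH] ul ln; first by rewrite edges_over_nil cards0.
rewrite -cat1s edges_over_cat cardsU disjoint_setI0 ?edges_over_disjoint //.
rewrite cards0 subn0 ln ?mem_head // IH ?mulSn //; first by case/andP: ul.
by move=> R Rl; apply: ln; rewrite inE Rl orbT.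
Qed.

Lemma edges_over_pair A B : A \in I -> B \in I -> A != B ->
  edges_over [:: [set A; B]] = crossing_triples A B.
Proof.
move=> AI BI AB; apply/setP => e; rewrite !inE andbC.
have [/eqP e3|] := boolP (#|e| == 3); last by rewrite !andbF.
have ABI : [set A; B] \subset I by rewrite subUset !sub1set AI.
have coverAB : cover [set A; B] = A :|: B by rewrite /cover big_setU1 ?inE ?big_set1.
rewrite !andbT -coverAB -sub_blocks //; apply/eqP/andP => [beAB|[+ be_sub]].
  have not_singleton X : blocks e != [set X].
    by apply: contra_eqN (cards2 A B) => /eqP; rewrite -beAB => ->; rewrite cards1 AB.
  by rewrite beAB subxx negb_or -!blocks1 ?not_singleton.
rewrite negb_or => /andP[eA eB]; apply/eqP; rewrite eqEsubset be_sub subUset !sub1set.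
have mem_blocks X Y :
    Y \in I -> e != Y -> blocks e \subset [set X; Y] -> X \in blocks e.
  move=> YI eY /subsetP beXY; apply: contraR eY => Xbe.
  rewrite -one_factor_sub_eq // -sub_blocks1 //; apply/subsetP => Z Zbe.
  by have := beXY Z Zbe; rewrite !inE; case: eqP Zbe Xbe => // -> ->.
by rewrite (mem_blocks A B) // (mem_blocks B A) // setUC.
Qed.

Lemma edges_over_triple A B C : A \in I -> B \in I -> C \in I -> uniq [:: A; B; C] ->
  edges_over [:: [set A; B; C]] = tripartite A B C.
Proof.
move=> AI BI CI; rewrite /= !inE negb_or => /andP[/andP[AB AC] /andP[BC _]].
have [dAB dABC] : [disjoint A & B] /\ [disjoint A :|: B & C].
  by rewrite disjointsUl !one_factor_disjoint.
apply/setP => e; rewrite !inE; apply/andP/idP => [[/eqP e3 /eqP beABC]|eABC].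
  have /imsetP[x xe xA] : A \in blocks e by rewrite beABC !inE eqxx.
  have /imsetP[y ye yB] : B \in blocks e by rewrite beABC !inE eqxx orbT.
  have /imsetP[z ze zC] : C \in blocks e by rewrite beABC !inE eqxx orbT.
  apply/tripartiteP; exists x, y, z.
  rewrite xA yB zC !mem_pblock !one_factor_cover; split=> //.
  have xyz3 : #|[set x; y; z]| = 3.
    have neq p q : pblock I p != pblock I q -> p != q by apply: contraNneq => ->.
    apply/eqP; rewrite card_set3; move: AB AC BC; rewrite xA yB zC /= !inE.
    by move=> /neq/negPf-> /neq/negPf-> /neq/negPf->.
  by apply/eqP; rewrite eq_sym eqEcard xyz3 e3 !subUset !sub1set xe ye ze.
rewrite (card_mem_tripartite dAB dABC eABC); split=> //.
case/tripartiteP: eABC => x [y [z [xA yB zC ->]]]; rewrite /blocks !imsetU !imset_set1.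
rewrite (def_pblock one_factor_trivIset AI xA) (def_pblock one_factor_trivIset BI yB).
by rewrite (def_pblock one_factor_trivIset CI zC).
Qed.

Lemma has_k_cycle_decomposition_edges_over_pairs l : uniq l ->
  {in l, forall S, S \subset I /\ #|S| = 2} ->
  has_k_cycle_decomposition 6 (edges_over l).
Proof.
elim: l => [|S l IH] ul pairs.
  by rewrite edges_over_nil; apply: has_k_cycle_decomposition0.
rewrite -cat1s edges_over_cat; apply: has_k_cycle_decompositionU.
- exact: edges_over_disjoint.
- have [SI S2] := pairs S (mem_head _ _).
  have [A [B [AI BI AB ->]]] := subset_cards2 SI S2; rewrite edges_over_pair //.
  apply: has_k_cycle_decomposition_crossing_triples; rewrite ?one_factor_mem_card //.
  exact: one_factor_disjoint.
- apply: IH => [|R Rl]; first by case/andP: ul.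
  by apply: pairs; rewrite inE Rl orbT.
Qed.

Lemma has_k_cycle_decomposition_edges_over_exchange S R :
  S \subset I -> R \subset I -> #|S| = 3 -> #|R| = 3 -> exchange S R ->
  has_k_cycle_decomposition 6 (edges_over [:: S; R]).
Proof.
move=> SI RI S3 R3 /andP[SR1 /cards1P[D RSD]].
have /cards2P[A [B [AB SRAB]]] : #|S :&: R| == 2.
  by have := cardsID R S; rewrite (eqP SR1) S3 addn1 => -[->].
have /cards1P[C SRC] := SR1.
have SE : S = [set A; B; C] by rewrite -SRAB -SRC setID.
have RE : R = [set A; B; D] by rewrite -SRAB -RSD setIC setID.
have CD : C != D.
  have /setDP[_ CR] : C \in S :\: R by rewrite SRC set11.
  have /setDP[DR _] : D \in R :\: S by rewrite RSD set11.
  by apply: contraNneq CR => ->.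
have uABC : uniq [:: A; B; C] by rewrite -card_set3 -SE S3.
have uABD : uniq [:: A; B; D] by rewrite -card_set3 -RE R3.
move: SI RI; rewrite SE RE !subUset !sub1set => /andP[/andP[AI BI] CI] /andP[_ DI].
rewrite -cat1s edges_over_cat !edges_over_triple // -tripartiteUr.
move: uABC uABD; rewrite /= !inE !negb_or.
move=> /and3P[/andP[_ AC] BC _] /and3P[/andP[_ AD] BD _].
have dABCD : [disjoint A :|: B & C :|: D].
  rewrite disjointsUl ![[disjoint _ & C :|: D]]disjoint_sym !disjointsUl.
  by rewrite !one_factor_disjoint // eq_sym.
apply: has_k_cycle_decomposition_tripartite => //;
  by rewrite ?one_factor_mem_card ?one_factor_disjoint.
Qed.

Lemma has_k_cycle_decomposition_edges_over_path l : uniq l -> sorted exchange l ->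
  ~~ odd (size l) -> {in l, forall S, S \subset I /\ #|S| = 3} ->
  has_k_cycle_decomposition 6 (edges_over l).
Proof.
have [n] := ubnP (size l); elim: n l => // n IH [|S [|R l]] //=.
  by rewrite edges_over_nil; move=> *; apply: has_k_cycle_decomposition0.
move=> ln ul /andP[SR lpath] lodd triples.
have [SI S3] : S \subset I /\ #|S| = 3 by apply: triples; rewrite !inE eqxx.
have [RI R3] : R \subset I /\ #|R| = 3 by apply: triples; rewrite !inE eqxx orbT.
rewrite -[[:: S, R & l]]/([:: S; R] ++ l) edges_over_cat.
apply: has_k_cycle_decompositionU; first exact: edges_over_disjoint.
  exact: has_k_cycle_decomposition_edges_over_exchange.
apply: IH.
- by lia.
- by case/and3P: ul.
- exact: path_sorted lpath.
- by rewrite -[odd _]negbK.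
- by move=> Q Ql; apply: triples; rewrite !inE Ql !orbT.
Qed.

Lemma complete3_minusE : complete3_minus I =
  edges_over (revolving_door (enum I) 2 ++ revolving_door (enum I) 3).
Proof.
apply/setP => e; rewrite !inE andbC; have [/eqP e3 /=|//] := boolP (#|e| == 3).
rewrite mem_cat !mem_revolving_door ?enum_uniq // mem_one_factor //.
have -> : blocks e \subset enum I.
  by apply/subsetP => B /(subsetP (blocks_sub e)); rewrite mem_enum.
have : #|blocks e| <= 3 by rewrite -e3 leq_imset_card.
have : 0 < #|blocks e|.
  have /card_gt0P[x xe] : 0 < #|e| by rewrite e3.
  by apply/card_gt0P; exists (pblock I x); apply: imset_f.
by case: #|blocks e| => [|[|[|[|]]]].
Qed.

Lemma revolving_door_one_factor S k : S \in revolving_door (enum I) k ->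
  S \subset I /\ #|S| = k.
Proof.
rewrite mem_revolving_door ?enum_uniq // => /andP[/subsetP SI /eqP Sk].
by split=> //; apply/subsetP => B /SI; rewrite mem_enum.
Qed.

Lemma card_edges_over_pair S : S \subset I -> #|S| = 2 -> #|edges_over [:: S]| = 18.
Proof.
move=> SI /(subset_cards2 SI)[A [B [AI BI AB ->]]]; rewrite edges_over_pair //.
by rewrite card_crossing_triples ?one_factor_disjoint ?one_factor_mem_card.
Qed.

Lemma card_edges_over_triple S : S \subset I -> #|S| = 3 -> #|edges_over [:: S]| = 27.
Proof.
move=> SI /(subset_cards3 SI)[A [B [C [AI BI CI uABC ->]]]].
rewrite edges_over_triple // card_tripartite ?one_factor_mem_card //;
  move: uABC; rewrite /= !inE negb_or => /and3P[/andP[AB AC] BC _].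
- exact: one_factor_disjoint.
- by rewrite disjointsUl !one_factor_disjoint.
Qed.

Lemma card_complete3_minus :
  #|complete3_minus I| = 18 * 'C(#|I|, 2) + 27 * 'C(#|I|, 3).
Proof.
have u23 := revolving_door_cat_uniq (enum_uniq I) (isT : 2 != 3).
have uniq_door k : uniq (revolving_door (enum I) k).
  by rewrite revolving_door_uniq ?enum_uniq.
rewrite complete3_minusE edges_over_cat cardsU disjoint_setI0 ?edges_over_disjoint //.
rewrite cards0 subn0 (@card_edges_over _ 18) ?(@card_edges_over _ 27) //.
- by rewrite !size_revolving_door -cardE mulnC (mulnC _ 27).
- by move=> S /revolving_door_one_factor[]; apply: card_edges_over_triple.
- by move=> S /revolving_door_one_factor[]; apply: card_edges_over_pair.
Qed.

Lemma has_k_cycle_decomposition_complete3_minus :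
  has_k_cycle_decomposition 6 (complete3_minus I) <-> ~~ odd 'C(#|I|, 3).
Proof.
split=> [[cs /card_k_cycle_decomposition]|even_bin].
  by rewrite card_complete3_minus => /(_ isT); lia.
rewrite complete3_minusE edges_over_cat; apply: has_k_cycle_decompositionU.
- by rewrite edges_over_disjoint ?revolving_door_cat_uniq ?enum_uniq.
- apply: has_k_cycle_decomposition_edges_over_pairs => [|S].
    by rewrite revolving_door_uniq ?enum_uniq.
  exact: revolving_door_one_factor.
- apply: has_k_cycle_decomposition_edges_over_path => [|||S].
  + by rewrite revolving_door_uniq ?enum_uniq.
  + by rewrite revolving_door_sorted ?enum_uniq.
  + by rewrite size_revolving_door -cardE.
  + exact: revolving_door_one_factor.
Qed.

End OneFactor.

Theorem theorem2 (v : nat) (Hv : 4 <= v) (H3 : 3 %| v)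
    (I : {set {set 'I_v}}) (HI : one_factor I) :
  has_k_cycle_decomposition 6 (complete3_minus I) <->
  (v %% 12 == 0) || (v %% 12 == 3) || (v %% 12 == 6).
Proof.
have v3 := card_one_factor HI.
rewrite has_k_cycle_decomposition_complete3_minus // odd_bin3.
by split; lia.
Qed.
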